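(* Let $f$ be a unimodal map satisfying the standing assumptions in the context, with kneading map $Q$. If $Q(k)$ is bounded and $c$ is infinitely recurrent (recurrent and not periodic), then $c$ is not persistently recurrent.
   Context: A unimodal map is a continuous $f:[0,1]\to[0,1]$ with a turning point $c\in(0,1)$ such that $f|_{[0,c]}$ is strictly increasing and $f|_{[c,1]}$ is strictly decreasing; $c_i=f^i(c)$. Standing assumptions: $c_2<c<c_1$ and $c_2<c_3$; $f$ has no periodic attractor and is not renormalizable (there is no $n>1$ and interval $J\subset[c_2,c_1]$ containing $c$ with $f^n(J)\subset J$ and $J,f(J),\dots,f^{n-1}(J)$ having disjoint interiors); the contraction principle holds: for every $\varepsilon>0$ there is $\delta>0$ such that $|f^n(J)|>\delta$ for every $n>0$ and every interval $J$ with $|J|>\varepsilon$. Recurrent means $c\in\omega(c)$. $\mathcal K(f)=e_1e_2\cdots$ with $e_i=1$ if $c_i>c$ and $e_i=0$ if $c_i<c$. Cutting times: $S_0=1$, $S_{k+1}=S_k+\min\{j\ge1:e_{S_k+j}\ne e_j\}$. The kneading map $Q$ is defined by $S_k-S_{k-1}=S_{Q(k)}$ for $k\ge1$. Persistent recurrence. For a finite backward orbit $\overline x=(x_{-l},\dots,x_{-1},x_0=x)$ and an interval $J\ni x$, the pull-back of $J$ along $\overline x$ is $J_0=J$, and $J_{k+1}\ni x_{-k-1}$ the largest interval with $f(J_{k+1})\subseteq J_k$; it is monotone if $c\notin J_k^\circ$ for all $1\le k\le l$. The recurrent point $c$ is reluctantly recurrent if there is $\delta>0$ such that for every $l\in\mathbb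 N$ there is a backward orbit $(x_{-l},\dots,x_{-1},x)$ in $\omega(c)$ such that $B(x,\delta)$ has a monotone pull-back along it; otherwise $c$ is persistently recurrent. *)

(* Defs.v *)
From HB Require Import structures.
From mathcomp Require Import all_boot all_order all_algebra.
From mathcomp Require Import all_classical all_reals.
From mathcomp Require Import topology normedtype sequences.

Set Implicit Arguments.
Unset Strict Implicit.
Unset Printing Implicit Defensive.

Import Order.TTheory GRing.Theory Num.Theory.
Import numFieldNormedType.Exports.

Local Open Scope classical_set_scope.
Local Open Scope ring_scope.

(* A map of [0,1] is a function on R of which only the restriction to [0,1] is
   constrained and used; f^n is iter n f, and c_i is iter i f c. *)

Section UnimodalMaps.
Variable R : realType.
Implicit Types (f : R -> R) (c p x y : R) (J : set R).

Definition unimodal f c : Prop :=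
  [/\ {within `[0, 1], continuous f},
      forall x, x \in `[0, 1] -> f x \in `[0, 1],
      0 < c < 1,
      {in `[0, c] &, forall x y, x < y -> f x < f y} &
      {in `[c, 1] &, forall x y, x < y -> f y < f x}].

(* Meant for bounded intervals. *)
Definition interval_length J : R := sup J - inf J.

Definition omega_limit f x : set R := cluster ((fun n => iter n f x) @ \oo).

Definition periodic f p : Prop := exists2 n, (0 < n)%N & iter n f p = p.

Definition recurrent f x : Prop := omega_limit f x x.

Definition forward_orbit f p : set R := range (fun n => iter n f p).

(* By compactness of [0,1], omega_limit f x `<=` forward_orbit f p says that f^n x
   converges to the periodic orbit of p. *)
Definition basin f p : set R :=
  [set x | x \in `[0, 1] /\ omega_limit f x `<=` forward_orbit f p].

(* Two-sided and one-sided attractors are both covered. *)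
Definition has_periodic_attractor f : Prop :=
  exists p, [/\ p \in `[0, 1], periodic f p & (basin f p)° !=set0].

(* 0 < interval_length J rules out the degenerate interval J = {c}, which would make
   every f with periodic c renormalizable. *)
Definition renormalizable f c : Prop :=
  exists (n : nat) J,
    [/\ (1 < n)%N,
        [/\ is_interval J, 0 < interval_length J,
            J `<=` `[iter 2 f c, iter 1 f c] & J c],
        iter n f @` J `<=` J &
        trivIset [set i | (i < n)%N] (fun i : nat => (iter i f @` J)°)].

Definition contraction_principle f : Prop :=
  forall eps : R, 0 < eps -> exists2 delta : R, 0 < delta &
    forall J, is_interval J -> J `<=` `[0, 1] -> eps < interval_length J ->
    forall n, (0 < n)%N -> delta < interval_length (iter n f @` J).

(* The entry e_i of the kneading sequence (1 is true, 0 is false), for i >= 1.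
   It is only meaningful if c_i <> c, which holds when c is not periodic. *)
Definition kneading f c (i : nat) : bool := c < iter i f c.

Definition is_cutting_times f c (S : nat -> nat) : Prop :=
  S 0%N = 1%N /\
  forall k, exists j : nat,
    [/\ S k.+1 = (S k + j)%N, (1 <= j)%N,
        kneading f c (S k + j) <> kneading f c j &
        forall i : nat, (1 <= i)%N -> kneading f c (S k + i) <> kneading f c i ->
          (j <= i)%N].

(* The value Q 0 is irrelevant. *)
Definition is_kneading_map f c (Q : nat -> nat) : Prop :=
  exists2 S, is_cutting_times f c S &
    forall k, (1 <= k)%N -> (S k - S k.-1)%N = S (Q k).

(* x k stands for x_{-k}, 0 <= k <= l. *)
Definition backward_orbit f (l : nat) (x : nat -> R) : Prop :=
  (forall k, (k <= l)%N -> x k \in `[0, 1]) /\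
  (forall k, (k < l)%N -> f (x k.+1) = x k).

Definition interval_into f J y (I : set R) : Prop :=
  [/\ is_interval I, I `<=` `[0, 1], I y & f @` I `<=` J].

Definition largest_interval_into f J y (I : set R) : Prop :=
  interval_into f J y I /\ forall I', interval_into f J y I' -> I' `<=` I.

Definition is_pullback f (l : nat) (x : nat -> R) J (Js : nat -> set R) : Prop :=
  Js 0%N = J /\
  forall k, (k < l)%N -> largest_interval_into f (Js k) (x k.+1) (Js k.+1).

Definition has_monotone_pullback f c (l : nat) (x : nat -> R) J : Prop :=
  exists2 Js, is_pullback f l x J Js &
    forall k, (1 <= k <= l)%N -> ~ (Js k)° c.

(* The ball is taken in R; intersecting it with [0,1] gives the same J_k for
   k >= 1, since f maps [0,1] to itself. *)
Definition reluctantly_recurrent f c : Prop :=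
  recurrent f c /\
  exists2 delta : R, 0 < delta &
    forall l : nat, exists x : nat -> R,
      [/\ backward_orbit f l x,
          forall k, (k <= l)%N -> omega_limit f c (x k) &
          has_monotone_pullback f c l x (ball (x 0%N) delta)].

Definition persistently_recurrent f c : Prop :=
  recurrent f c /\ ~ reluctantly_recurrent f c.

End UnimodalMaps.

(* Main.v *)
Require Import Defs.
From mathcomp Require Import all_boot all_order all_algebra.
From mathcomp Require Import all_classical all_reals.
From mathcomp Require Import topology normedtype sequences.
From mathcomp Require Import zify lra.

(** Since [Q] is bounded, the kneading sequences seen from [c_{S_k}] and from [c]
    differ within a bounded time, so the points [c_{S_k}] stay away from [c].
    Follow the orbit of [c_3] in [(c_2, c_1)], cutting the interval around it at [c]
    whenever necessary.  The images are intervals [(c_a, c_b)] of the Hofbauer tower,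
    [a = S_k + b <= S_{k+1}], and when such an interval contains [c] both [a] and [b]
    are cutting times.  At a closest return [c_n] to [c], the interval around
    [c_n] has end points [c_a, c_b] with [a, b < n], farther from [c] than [c_n];
    so it contains [c], hence a ball of definite size about [c_n], and the pull-back
    of this ball along [c_3, ..., c_n] is monotone by construction. *)

Set Implicit Arguments.
Unset Strict Implicit.
Unset Printing Implicit Defensive.

Import Order.TTheory GRing.Theory Num.Theory.
Import numFieldNormedType.Exports.

Local Open Scope classical_set_scope.
Local Open Scope ring_scope.

Section Reluctance.
Variable R : realType.
Implicit Types (f : R -> R) (c u v x y z : R) (I J : set R).

(** * Open intervals with end points in either order *)

Definition between u v x : bool := (u < x < v) || (v < x < u).

Lemma between_sym u v x : between u v x = between v u x.
Proof. by rewrite /between orbC. Qed.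

Lemma between_split u v x z :
  between u v x -> between u v z -> x != z -> between u z x || between v z x.
Proof. rewrite /between; lra. Qed.

Lemma between_between u v x z : between u v z -> between u z x -> between u v x.
Proof. rewrite /between; lra. Qed.

(** An interval through [y] that left the region between [u] and [v] would have to pass through [u]
    or [v]. *)
Lemma between_interval I u v y :
  is_interval I -> I y -> between u v y -> ~ I u -> ~ I v -> I `<=` between u v.
Proof.
move=> Iint Iy yuv Iu Iv z Iz; rewrite /=; apply: contrapT => nz.
have [zu|zu] := eqVneq z u; first by apply: Iu; rewrite -zu.
have [zv|zv] := eqVneq z v; first by apply: Iv; rewrite -zv.
have [P|P] : (y <= u <= z \/ z <= u <= y) \/ (y <= v <= z \/ z <= v <= y).
- move: nz yuv zu zv; rewrite /between => /negP; lra.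
- by apply: Iu; case: P => P; [apply: Iint Iy Iz _ P|apply: Iint Iz Iy _ P].
- by apply: Iv; case: P => P; [apply: Iint Iy Iz _ P|apply: Iint Iz Iy _ P].
Qed.

(** * Order and continuity properties of the iterates *)

Lemma unimodal_between f c u v x : unimodal f c ->
  u \in `[0, 1] -> v \in `[0, 1] -> ~~ between u v c ->
  between u v x -> between (f u) (f v) (f x).
Proof.
move=> [_ _ c01 finc fdec]; rewrite !in_itv /= => u01 v01 nc xuv.
have [P|P] : (u <= c /\ v <= c) \/ (c <= u /\ c <= v).
- by move: nc xuv; rewrite /between; lra.
- have H y z : 0 <= y -> z <= c -> y < z -> f y < f z.
    by move=> *; apply: finc => //; rewrite in_itv /=; lra.
  by case/orP: xuv => /andP[A B]; apply/orP; [left|right]; apply/andP; split;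
    apply: H => //; lra.
- have H y z : c <= y -> z <= 1 -> y < z -> f z < f y.
    by move=> *; apply: fdec => //; rewrite in_itv /=; lra.
  by case/orP: xuv => /andP[A B]; apply/orP; [right|left]; apply/andP; split;
    apply: H => //; lra.
Qed.

Lemma unimodal_iter_itv f c n : unimodal f c -> iter n f c \in `[0, 1].
Proof.
move=> [_ f01 /andP[c0 c1] _ _]; elim: n => [|n IHn] /=; last exact: f01.
by rewrite in_itv /= !ltW.
Qed.

Lemma unimodal_continuous_at f c y : unimodal f c -> y \in `[0, 1] ->
  forall e, 0 < e -> exists2 d, 0 < d &
    forall z, z \in `[0, 1] -> `|z - y| < d -> `|f z - f y| < e.
Proof.
move=> [fc _ _ _ _] y01 e e0.
move/subspace_continuousP: fc => /(_ y y01) /cvgrPdist_lt /(_ e e0).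
move=> /nbhs_ballP[d /= d0 H]; exists d => // z z01 zy.
by rewrite distrC; apply: H => //; rewrite /ball /= distrC.
Qed.

Lemma unimodal_continuous_iter f c n : unimodal f c ->
  forall e, 0 < e -> exists2 d, 0 < d &
    forall i, `|iter i f c - c| < d -> `|iter (i + n) f c - iter n f c| < e.
Proof.
move=> fU; elim: n => [|n IHn] e e0; first by exists e => // i; rewrite addn0.
have [d d0 Hd] := unimodal_continuous_at fU (unimodal_iter_itv n fU) e0.
have [d' d'0 Hd'] := IHn d d0; exists d' => // i /Hd' H.
by rewrite addnS /=; apply: Hd => //; exact: unimodal_iter_itv.
Qed.

(** * Recurrence and closest returns *)

Lemma omega_limitP f x y : omega_limit f x y <->
  forall e N, 0 < e -> exists2 n, (N <= n)%N & `|iter n f x - y| < e.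
Proof.
split=> [H e N e0|H A B [N _ AN] /nbhs_ballP[e /= e0 Be]].
  have [//|_ [[n /= Nn <-]]] := H [set iter n f x | n in [set n | (N <= n)%N]]
    (ball y e) _ (nbhsx_ballx y e e0).
    by exists N => // n /= Nn; exists n.
  by rewrite /ball /= distrC; exists n.
have [n Nn Hn] := H e N e0.
by exists (iter n f x); split; [exact: AN|apply: Be; rewrite /ball /= distrC].
Qed.

Lemma recurrent_omega_limit_iter f c n : unimodal f c -> recurrent f c ->
  omega_limit f c (iter n f c).
Proof.
move=> fU /omega_limitP rec; apply/omega_limitP => e N e0.
have [d d0 Hd] := unimodal_continuous_iter n fU e0.
have [m Nm /Hd Hm] := rec d N d0; exists (m + n)%N => //.
exact: leq_trans Nm (leq_addr _ _).
Qed.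

Lemma not_periodic_neq f c n : ~ periodic f c -> (0 < n)%N -> iter n f c != c.
Proof. by move=> nper n0; apply/eqP => H; apply: nper; exists n. Qed.

(** Take the first time the orbit comes within [d] of [c], where [d <= e] is at most the distance
    from [c] to each of its first [K - 1] iterates. Being first makes the return both late and
    closest. *)
Lemma closest_return f c : recurrent f c -> ~ periodic f c ->
  forall e K, 0 < e -> exists n, [/\ (K <= n)%N, `|iter n f c - c| < e &
    forall j, (0 < j < n)%N -> `|iter n f c - c| < `|iter j f c - c|].
Proof.
move=> /omega_limitP rec nper e K e0.
have [d [d0 de Hd]] : exists d, [/\ 0 < d, d <= e &
    forall j, (0 < j < K)%N -> d <= `|iter j f c - c|].
  elim: K => [|K [d [d0 de Hd]]]; first by exists e; split => // j; lia.
  have [->|K0] := posnP K; first by exists e; split => // j; lia.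
  exists (Num.min d `|iter K f c - c|); split.
  - by rewrite lt_min d0 normr_gt0 subr_eq0 not_periodic_neq.
  - by rewrite ge_min de.
  - move=> j /andP[j0]; rewrite ltnS leq_eqVlt => /orP[/eqP->|jK].
      by rewrite ge_min lexx orbT.
    by rewrite ge_min Hd ?j0.
have exn : exists n, (0 < n)%N && (`|iter n f c - c| < d).
  by have [n n0 Hn] := rec d 1%N d0; exists n; rewrite n0.
have [n /andP[n0 nd] nmin] := ex_minnP exn.
have far j : (0 < j < n)%N -> d <= `|iter j f c - c|.
  move=> /andP[j0 jn]; rewrite leNgt; apply/negP => H.
  by have := nmin j; rewrite j0 H leqNgt jn => /(_ isT).
exists n; split; last by move=> j /far; exact: lt_le_trans.
- by rewrite leqNgt; apply/negP => nK; have := Hd n; rewrite n0 nK; lra.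
- exact: lt_le_trans de.
Qed.

(** * Cutting times under a bounded kneading map *)

(** None of the finitely many points [c_1, ..., c_N] equals [c], so by continuity nearby orbits stay
    on the same sides of [c] for [N] steps. *)
Lemma kneading_near f c N : unimodal f c -> ~ periodic f c ->
  exists2 d, 0 < d & forall i j, `|iter i f c - c| < d -> (0 < j <= N)%N ->
    kneading f c (i + j) = kneading f c j.
Proof.
move=> fU nper; elim: N => [|N [d d0 Hd]]; first by exists 1 => // i j; lia.
have e0 : 0 < `|iter N.+1 f c - c|.
  by rewrite normr_gt0 subr_eq0 not_periodic_neq.
have [d' d'0 Hd'] := unimodal_continuous_iter N.+1 fU e0.
exists (Num.min d d') => [|i j]; first by rewrite lt_min d0.
rewrite lt_min => /andP[id /Hd' id'] /andP[j0].
rewrite leq_eqVlt => /orP[/eqP->|jN]; last by apply: Hd; rewrite ?j0.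
rewrite /kneading; move: id'.
set p := iter _ f c; set q := iter _ f c => pq.
move: pq; rewrite ltr_norml.
by have [qc|qc] := lerP c q => pq; apply/idP/idP; lra.
Qed.

(** The itineraries of [c_{S_k}] and [c] disagree at time [S_{k+1} - S_k = S_{Q(k+1)}], which is at
    most the maximum of [S_0, ..., S_B]; this bounds the distance from below uniformly in [k]. *)
Lemma cutting_times_far f c (S Q : nat -> nat) B : unimodal f c ->
  ~ periodic f c -> is_cutting_times f c S ->
  (forall k, (1 <= k)%N -> (S k - S k.-1)%N = S (Q k)) ->
  (forall k, (1 <= k)%N -> (Q k <= B)%N) ->
  exists2 d, 0 < d & forall k, d <= `|iter (S k) f c - c|.
Proof.
move=> fU nper [_ Scut] SQ QB.
have [d d0 Hd] := kneading_near (\max_(i < B.+1) S i)%N fU nper.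
exists d => // k; rewrite leNgt; apply/negP => kd.
have [j [Sk j1 neq _]] := Scut k; apply: neq; apply: Hd => //; rewrite j1 /=.
have -> : j = S (Q k.+1) by rewrite -SQ //= Sk addKn.
have Qk : (Q k.+1 < B.+1)%N by rewrite ltnS QB.
exact: (leq_bigmax (Ordinal Qk)).
Qed.

(** * Existence of pull-backs *)

(** The union of all admissible intervals is an interval because they share [y]. *)
Lemma largest_interval_into_ex f J y : y \in `[0, 1] -> J (f y) ->
  exists I, largest_interval_into f J y I.
Proof.
move=> y01 Jy; exists (\bigcup_(I in interval_into f J y) I); split.
- have yI : interval_into f J y [set y].
    split => //; last by move=> _ [_ -> <-].
      by move=> a b /= -> -> z /andP[yz zy]; apply/eqP; rewrite eq_le zy.
    by move=> _ ->.
  split; last by move=> _ [z [I [_ _ _ fI] Iz] <-]; apply: fI; exists z.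
  + move=> a b [I II Ia] [I' II' Ib] z /andP[az zb].
    have [zy|yz] := leP z y.
      by exists I => //; case: II => Iint _ Iy _; apply: Iint Ia Iy _ _; rewrite az.
    exists I' => //; case: II' => Iint _ Iy _; apply: Iint Iy Ib _ _.
    by rewrite (ltW yz).
  + by move=> z [I [_ I01 _ _] /I01].
  + by exists [set y].
- by move=> I II z Iz; exists I.
Qed.

Lemma pullback_ex f l (x : nat -> R) J : backward_orbit f l x -> J (x 0%N) ->
  exists Js, is_pullback f l x J Js.
Proof.
move=> [x01 fx] J0.
(* The default [set0] is never reached for [k < l], since [x k] stays in [Js k]. *)
pose G k I := xget set0 [set I' | largest_interval_into f I (x k.+1) I'].
pose Js := fix Js k := if k is k'.+1 then G k' (Js k') else J.
exists Js; split => //.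
have GP k : (k < l)%N -> Js k (x k) ->
    largest_interval_into f (Js k) (x k.+1) (Js k.+1).
  move=> kl Jk; have [I II] : exists I, largest_interval_into f (Js k) (x k.+1) I.
    by apply: largest_interval_into_ex; [exact: x01|rewrite fx].
  exact: (xgetPex set0 (ex_intro _ I II)).
have JsP k : (k <= l)%N -> Js k (x k).
  elim: k => // k IHk kl.
  by have [[]] := GP k kl (IHk (ltnW kl)).
by move=> k kl; apply: GP => //; apply: JsP; exact: ltnW.
Qed.

(** * Monotone pull-backs and the Hofbauer tower *)

(* Every pull-back of a subset of the open interval between [u] and [v] along
   [c_3, ..., c_{i+3}] is monotone. *)
Definition monotone_up_to f c i u v : Prop := forall l Js, (l <= i)%N ->
  Js 0%N `<=` between u v ->
  is_pullback f l (fun j => iter (i.+3 - j) f c) (Js 0%N) Js ->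
  forall j, (1 <= j <= l)%N -> ~ Js j c.

(** The first pull-back contains [c_{i+3}] but neither [u] nor [v], whose images are end points of
    an open interval. So it lies between [u] and [v], misses [c], and the later pull-backs fall
    under the hypothesis for [i]. *)
Lemma monotone_up_to_step f c i u v : ~~ between u v c ->
  between u v (iter i.+3 f c) ->
  monotone_up_to f c i u v -> monotone_up_to f c i.+1 (f u) (f v).
Proof.
move=> nc xuv mono [|l] Js li J0 [_ Jpull] j; first by lia.
have J1 : Js 1%N `<=` between u v.
  have [[Iint _ Iy fI] _] := Jpull 0%N isT.
  apply: (between_interval Iint Iy); first by rewrite subn1.
  - move=> Ju; have /J0 : Js 0%N (f u) by apply: fI; exists u.
    by rewrite /between /= !ltxx andbF.
  - move=> Jv; have /J0 : Js 0%N (f v) by apply: fI; exists v.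
    by rewrite /between /= !ltxx andbF.
have nJ1 : ~ Js 1%N c by move=> /J1; exact/negP.
case: j => // -[|j] // jl.
apply: (mono l (fun j => Js j.+1)) => //; split => // k kl.
by have := Jpull k.+1 kl; rewrite !subSS.
Qed.

Lemma monotone_up_to_sub f c i u v u' v' :
  between u' v' `<=` between u v -> monotone_up_to f c i u v ->
  monotone_up_to f c i u' v'.
Proof.
by move=> sub mono l Js li J0; apply: mono => // z /J0; exact: sub.
Qed.

(** The end points lie on opposite sides of [c] exactly when their kneading entries differ, and
    [S k.+1] marks the first such difference. *)
Lemma tower_cut f c (S : nat -> nat) k b : ~ periodic f c ->
  is_cutting_times f c S -> (0 < b)%N -> (S k + b <= S k.+1)%N ->
  between (iter (S k + b) f c) (iter b f c) c = (S k + b == S k.+1)%N.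
Proof.
move=> nper [_ Scut] b0 bS; have [j [Sk j1 neq jmin]] := Scut k.
have -> : between (iter (S k + b) f c) (iter b f c) c =
    (kneading f c (S k + b) != kneading f c b).
  have := not_periodic_neq nper b0.
  have /(not_periodic_neq nper) : (0 < S k + b)%N by rewrite addn_gt0 b0 orbT.
  rewrite /between /kneading.
  by case: (ltrgtP (iter b f c) c); case: (ltrgtP (iter (S k + b) f c) c).
rewrite Sk eqn_add2l; apply/idP/eqP => [/eqP /(jmin b b0)|->]; last exact/eqP.
by move: bS; rewrite Sk leq_add2l => bj jb; apply/eqP; rewrite eqn_leq bj.
Qed.

Lemma tower_interval f c (S Q : nat -> nat) : unimodal f c ->
  iter 2 f c < c < iter 1 f c -> iter 2 f c < iter 3 f c -> ~ periodic f c ->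
  is_cutting_times f c S ->
  (forall k, (1 <= k)%N -> (S k - S k.-1)%N = S (Q k)) ->
  forall i, exists k b, [/\ (0 < b)%N, (S k + b <= S k.+1)%N, (S k + b <= i.+2)%N,
    between (iter (S k + b) f c) (iter b f c) (iter i.+3 f c) &
    monotone_up_to f c i (iter (S k + b) f c) (iter b f c)].
Proof.
move=> fU /andP[c2c cc1] c23 nper HS SQ.
have [S0 Scut] := HS.
have Slt k : (S k + 1 <= S k.+1)%N.
  by have [j [-> j1 _ _]] := Scut k; rewrite leq_add2l.
have itv n := unimodal_iter_itv n fU.
elim=> [|i [k [b [b0 bS bi xab mono]]]].
  (* The start is [(c_2, c_1)]; here [c_3 < c_1] because [c_2 < c] and [f] increases left of [c]. *)
  exists 0%N, 1%N; split => //; first by rewrite S0.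
    rewrite S0 /between c23 /=; apply/orP; left.
    have [_ _ c01 finc _] := fU; have := itv 2%N; move: c2c.
    rewrite -[f (f (f c))]/(f (iter 2 f c)); set y := iter 2 f c => yc.
    rewrite in_itv /= => /andP[y0 _].
    by apply: finc => //; rewrite in_itv /=; lra.
  by move=> [|l] // Js _ _ _ j; lia.
have [cut|ncut] := boolP (between (iter (S k + b) f c) (iter b f c) c); last first.
  have aS : (S k + b.+1 <= S k.+1)%N.
    by rewrite addnS ltn_neqAle bS andbT -(tower_cut nper HS).
  exists k, b.+1; rewrite addnS; split => //; first by rewrite -addnS.
    exact: (unimodal_between fU (itv _) (itv _) ncut xab).
  exact: monotone_up_to_step.
(* After a cut, the half kept has end points [c_{S_m}] and [c]; its image, with end points
   [c_{S_m+1}] and [c_1], is again a tower interval, with [b = 1]. Both halves qualify, since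
   [S k + b = S k.+1] and [b = S (Q k.+1)]. *)
have cutS m : (S m <= i.+2)%N -> between (iter (S m) f c) c (iter i.+3 f c) ->
    monotone_up_to f c i (iter (S m) f c) c ->
    exists k b, [/\ (0 < b)%N, (S k + b <= S k.+1)%N, (S k + b <= i.+3)%N,
      between (iter (S k + b) f c) (iter b f c) (iter i.+4 f c) &
      monotone_up_to f c i.+1 (iter (S k + b) f c) (iter b f c)].
  have ncut u : ~~ between u c c by rewrite /between !ltxx andbF.
  move=> mi xm monom; exists m, 1%N; rewrite !addn1; split => //.
  - by rewrite -addn1.
  - exact: (unimodal_between fU (itv _) (itv 0%N) (ncut _) xm).
  - exact: monotone_up_to_step.
have aS : (S k + b)%N = S k.+1 by apply/eqP; rewrite -(tower_cut nper HS).
have bQ : b = S (Q k.+1) by rewrite -SQ //= -aS addKn.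
have xc : iter i.+3 f c != c by exact: not_periodic_neq.
case/orP: (between_split xab cut xc) => [xa|xb].
- apply: (cutS k.+1); rewrite -aS //.
  by apply: (monotone_up_to_sub _ mono) => z; exact: between_between.
- apply: (cutS (Q k.+1)); rewrite -bQ //.
    by apply: leq_trans bi; exact: leq_addl.
  apply: (monotone_up_to_sub _ mono) => z zb; rewrite between_sym in cut.
  by rewrite /= between_sym; exact: between_between cut zb.
Qed.

End Reluctance.

Local Close Scope classical_set_scope.

Theorem theorem6p2 (R : realType) (f : R -> R) (c : R) (Q : nat -> nat)
  (hf : unimodal f c)
  (hc : iter 2 f c < c < iter 1 f c)
  (hc23 : iter 2 f c < iter 3 f c)
  (hattr : ~ has_periodic_attractor f)
  (hrenorm : ~ renormalizable f c)
  (hcontr : contraction_principle f)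
  (hQ : is_kneading_map f c Q)
  (hbound : exists B : nat, forall k : nat, (1 <= k)%N -> (Q k <= B)%N)
  (hrec : recurrent f c)
  (hper : ~ periodic f c) :
  ~ persistently_recurrent f c.
Proof.
case=> _; apply; split => //.
have [S HS SQ] := hQ; have [B QB] := hbound.
have [d d0 far] := cutting_times_far hf hper HS SQ QB.
(* Half of [d] bounds the distance from [c_n] to [c], the other half is the radius of the ball: the
   ball then stays within [d] of [c]. *)
have d20 : 0 < d / 2 by lra.
exists (d / 2) => // l.
(* The bound [l.+3] leaves room for [l] backward steps from [c_n] that end no earlier than [c_3]. *)
have [n [ln nd nclose]] := closest_return hrec hper l.+3 d20.
have [i ni] : exists i, n = i.+3 by exists (n - 3)%N; lia.
subst n.
have [k [b [b0 bS bi xab mono]]] := tower_interval hf hc hc23 hper HS SQ i.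
(* If both end points were on one side of [c], the one nearer to [c] would be closer than [c_n],
   against the choice of [n], as both indices are below [n]. *)
have cut : between (iter (S k + b) f c) (iter b f c) c.
  have := nclose (S k + b)%N; have := nclose b.
  move=> /(_ ltac:(lia)) + /(_ ltac:(lia)).
  move: xab; rewrite /between.
  set u := iter (S k + b) f c; set v := iter b f c; set x := iter _ f c.
  rewrite !ltr_norml; have := ler_norm (x - c); have := ler_norm (c - x).
  rewrite (distrC c x).
  have [uc|uc] := lerP c u; have [vc|vc] := lerP c v; lra.
have aS : (S k + b)%N = S k.+1 by apply/eqP; rewrite -(tower_cut hper HS).
have bQ : b = S (Q k.+1) by rewrite -SQ //= -aS addKn.
have ua := far k.+1; have vb := far (Q k.+1).
rewrite -aS in ua; rewrite -bQ in vb.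
(* The end points are on opposite sides of [c], each at distance at least [d]. *)
have ballab z : ball (iter i.+3 f c) (d / 2) z ->
    between (iter (S k + b) f c) (iter b f c) z.
  move: cut ua vb nd; rewrite /between.
  set u := iter (S k + b) f c; set v := iter b f c; set x := iter i.+3 f c.
  rewrite /ball /= !ltr_norml.
  by have [uc|uc] := lerP c u; have [vc|vc] := lerP c v; lra.
have orb : backward_orbit f l (fun j => iter (i.+3 - j) f c).
  split => j jl; first exact: (unimodal_iter_itv (i.+3 - j) hf).
  by rewrite -iterS -subSn ?subSS //; lia.
have x0 : ball (iter (i.+3 - 0) f c) (d / 2) (iter (i.+3 - 0) f c).
  exact: ballxx.
have [Js Jpull] := pullback_ex orb x0.
exists (fun j => iter (i.+3 - j) f c); split => //.
  by move=> j _; exact: recurrent_omega_limit_iter.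
exists Js => // j jl /interior_subset; case: (Jpull) => J0 _.
by apply: (mono l Js) => //; rewrite J0 // subn0.
Qed.
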